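(* For any $\tau>1$ and any bounded measurable set $\Omega\subset\mathbb R^2$, there is an explicit algorithm that takes any $f\in L^{2,\infty}(\Omega)$ and constructs a solution $\mathbf u$ of $\operatorname{div}\mathbf u=f$ such that $$\|\mathbf u\|_{L^\infty}\le\tau\|f\|_{L^{2,\infty}}.$$ More precisely, assume without loss of generality that $\Omega=[-R,R]^2$ for some $R>0$ and $\|f\|_{L^{2,\infty}(\Omega)}=1$, and define $f$ to be zero outside $\Omega$. Then the algorithm constructs a disjoint splitting $\Omega=\Omega_1\cup\Omega_2$ (the functions $f_1,f_2$ below being determined on all of $\Omega$ except for a set of measure zero) such that, with $f_j:=f\chi_{\Omega_j}$ for $j=1,2$, $$\int_{-\infty}^\infty|f_1(s,y)|\,ds\le\tau,\qquad \int_{-\infty}^\infty|f_2(x,s)|\,ds\le\tau\qquad\text{for all }x,y\in\mathbb R,$$ and the solution is $\mathbf u=(u_1,u_2)$ with $$u_1(x,y):=\int_{-\infty}^xf_1(s,y)\,ds,\qquad u_2(x,y):=\int_{-\infty}^yf_2(x,s)\,ds.$$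
   Context: The norm $\|f\|_{L^{2,\infty}}$ used here is the smallest constant $C$ such that $\int_E|f|\le C|E|^{1/2}$ for all measurable sets $E\subset\Omega$ (an equivalent norm on weak-$L^2$), where $|E|$ is Lebesgue measure. $\chi_E$ is the characteristic function of $E$. For a vector field, $\|\mathbf u\|_{L^\infty}=\operatorname{ess\,sup}|\mathbf u|_2$ with $|\cdot|_2$ the Euclidean norm. The divergence is in the sense of distributions. The algorithm: starting with $\Omega^0=\Omega$, at each step one considers the restriction of $f$ to the current set $\Omega^k$; on the horizontal lines along which the integral of $|f|\chi_{\Omega^k}$ is at most $\tau$ one sets $f_1=f$, $f_2=0$; on the part of the remaining set lying on vertical lines along which the integral of $|f|\chi_{\Omega^k}$ is at most $\tau$ one sets $f_2=f$, $f_1=0$; what is left of $\Omega^k$ is $\Omega^{k+1}$, and the step is repeated with $\Omega^{k+1}$ in place of $\Omega^k$.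
   Formalization: The displayed u can exceed τ in Euclidean length, so only |u_1|,|u_2| ≤ τ is stated for it; the bound ‖u‖ ≤ τ‖f‖ is proved for u minus half of the total line integrals of f_1, f_2 (same divergence). Ω and f are taken Borel measurable. *)

(* Defs.v *)
(* "Measurable" means Borel measurable, so that every
   horizontal and vertical section of a measurable function is measurable. *)
From HB Require Import structures.
From mathcomp Require Import all_boot all_order all_algebra.
From mathcomp Require Import all_classical all_reals all_analysis.
From mathcomp Require Import ess_sup_inf.
Set Implicit Arguments.
Unset Strict Implicit.
Unset Printing Implicit Defensive.
Import Order.TTheory GRing.Theory Num.Theory numFieldNormedType.Exports.
Local Open Scope classical_set_scope.
Local Open Scope ring_scope.

Notation leb1 R := (@lebesgue_measure R) (only parsing).
Notation leb2 R := (@lebesgue_measure R \x @lebesgue_measure R)%E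
  (only parsing).

Section WeakL2.
Context {R : realType}.
Implicit Types (Omega : set (R * R)) (f : R * R -> R).

(* The constraint 0 <= C only matters when Omega is a null set. *)
Definition weakL2_norm Omega f : \bar R :=
  ereal_inf [set C%:E | C in [set C : R | 0 <= C /\
    forall E : set (R * R), measurable E -> E `<=` Omega ->
      (\int[leb2 R]_(z in E) `|f z|%:E <= C%:E * (leb2 R E) `^ 2^-1)%E]].

Definition weakL2 Omega f : Prop :=
  measurable_fun Omega f /\ (weakL2_norm Omega f < +oo)%E.

Definition square (r : R) : set (R * R) := `[- r, r] `*` `[- r, r].

End WeakL2.

Section Divergence.
Context {R : realType}.
Implicit Types (f phi : R * R -> R) (u : R * R -> R * R).

Definition dx phi : R * R -> R := 'D_((1, 0) : R * R) phi.
Definition dy phi : R * R -> R := 'D_((0, 1) : R * R) phi.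

Fixpoint Ck (n : nat) phi : Prop :=
  continuous phi /\
  if n is m.+1 then
    [/\ forall z : R * R, derivable phi z ((1, 0) : R * R),
        forall z : R * R, derivable phi z ((0, 1) : R * R),
        Ck m (dx phi) & Ck m (dy phi)]
  else True.

Definition test_function phi : Prop :=
  (forall n, Ck n phi) /\ compact (closure [set z | phi z != 0]).

(* div u = f in the sense of distributions on the whole plane; it is only used
   for bounded u and integrable f. *)
Definition distributional_div u f : Prop :=
  forall phi, test_function phi ->
    \int[leb2 R]_z ((u z).1 * dx phi z + (u z).2 * dy phi z)
      = - \int[leb2 R]_z (f z * phi z).

Definition eucl_norm (v : R * R) : R := Num.sqrt (v.1 ^+ 2 + v.2 ^+ 2).

Definition Linfty_norm u : \bar R :=
  ess_sup (leb2 R) (fun z => (eucl_norm (u z))%:E).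

End Divergence.

Section Algorithm.
Context {R : realType}.
Variables (tau : R) (Omega : set (R * R)) (f : R * R -> R).
Implicit Types A : set (R * R).

Definition hmass A (y : R) : \bar R :=
  (\int[leb1 R]_s `|(f \_ A) (s, y)|%:E)%E.

Definition vmass A (x : R) : \bar R :=
  (\int[leb1 R]_s `|(f \_ A) (x, s)|%:E)%E.

Definition hpart A : set (R * R) :=
  [set z | A z /\ (hmass A z.2 <= tau%:E)%E].

(* Vertical masses are those of the current set A, not of A `\` hpart A. *)
Definition vpart A : set (R * R) :=
  [set z | (A `\` hpart A) z /\ (vmass A z.1 <= tau%:E)%E].

Definition next A : set (R * R) := A `\` (hpart A `|` vpart A).

Definition stage (k : nat) : set (R * R) := iter k next Omega.

Definition residual : set (R * R) := \bigcap_k stage k.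

(* The algorithm leaves the assignment of the residual set open (it is a null
   set); it is put into Omega1 so that Omega1 and Omega2 cover Omega. *)
Definition Omega1 : set (R * R) := \bigcup_k hpart (stage k) `|` residual.

Definition Omega2 : set (R * R) := \bigcup_k vpart (stage k).

End Algorithm.

Section Fields.
Context {R : realType}.
Implicit Types f : R * R -> R.

Definition primitive_field f1 f2 (z : R * R) : R * R :=
  (\int[leb1 R]_(s in `]-oo, z.1]) f1 (s, z.2),
   \int[leb1 R]_(s in `]-oo, z.2]) f2 (z.1, s)).

(* primitive_field f1 f2 minus the divergence-free field (a y, b x), where a y
   and b x are half of the total integrals of f1 along the horizontal line at
   height y and of f2 along the vertical line at abscissa x.  The components of
   primitive_field are only bounded by tau, which does not bound its Euclidean
   length by tau; those of balanced_field are bounded by tau / 2. *)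
Definition balanced_field f1 f2 (z : R * R) : R * R :=
  ((primitive_field f1 f2 z).1 - 2^-1 * \int[leb1 R]_s f1 (s, z.2),
   (primitive_field f1 f2 z).2 - 2^-1 * \int[leb1 R]_s f2 (z.1, s)).

(* The algorithm run on f normalised to have weak L^2 norm 1 (on f / 0 = 0 if
   the norm vanishes). *)
Definition solution (tau : R) (Omega : set (R * R)) f (z : R * R) : R * R :=
  let N := fine (weakL2_norm Omega f) in
  let g := (fun w => f w / N) \_ Omega in
  N *: balanced_field (g \_ (Omega1 tau Omega g)) (g \_ (Omega2 tau Omega g)) z.

End Fields.

(* Main.v *)
Require Import Defs.
From HB Require Import structures.
From mathcomp Require Import all_boot all_order all_algebra.
From mathcomp Require Import all_classical all_reals all_analysis.
From mathcomp Require Import ess_sup_inf measurable_realfun.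
From mathcomp Require Import lra.
Set Implicit Arguments.
Unset Strict Implicit.
Unset Printing Implicit Defensive.
Import Order.TTheory GRing.Theory Num.Theory numFieldNormedType.Exports.
Local Open Scope classical_set_scope.
Local Open Scope ring_scope.

(** On the k-th stage A of the algorithm let X and Y be the sets of abscissas and
ordinates of the lines on which the integral of |f| over A exceeds tau.  The next
stage is the intersection of A with X * Y.  With m the integral of |f| over A,
Markov's inequality gives |X|, |Y| <= m / tau, so the weak L^2 bound gives at
most (|X| |Y|)^(1/2) <= m / tau for the integral over the next stage.  Hence
|X| and |Y| decay geometrically, and the residual set lies in a product of two
null sets of the line: it is null in the plane and on every line.  On every
other row (column) the set Omega1 (Omega2) is contained in the first stage whose
mass there is at most tau.

Both primitive_field and balanced_field have components of the form
P_c h(x) = \int_(s <= x) h(s) ds - c \int h, with c = 0 and c = 1/2.  By Fubini's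
theorem and the fundamental theorem of calculus \int (P_c h) psi' = - \int h psi
whenever psi has compact support, which yields the divergence line by line. *)

(** * Measurability and Fubini's theorem in the plane *)

(** The sigma-algebra of the plane is generated by rectangles, so an open set is exhibited as a
    countable union of them: the squares with rational centre and rational radius that it
    contains. *)
Lemma open_prod_measurable (R : realType) (O : set (R * R)) :
  open O -> measurable O.
Proof.
move=> oO.
pose B (q : rat * rat * rat) : set (R * R) :=
  ball (ratr q.1.1 : R) (ratr q.2 : R) `*` ball (ratr q.1.2 : R) (ratr q.2).
pose I := [set q | B q `<=` O].
have -> : O = \bigcup_(q in I) B q.
  apply/seteqP; split => [[x y] Oxy|z [q Iq /Iq]//].
  have [e /= e0 xyO] : nbhs_ball ((x, y) : R * R) O.
    by rewrite nbhs_ballE; exact: open_nbhs_nbhs.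
  (* With [r < e / 2] and each coordinate of the centre within [r] of that of the point, the square
     contains [(x, y)] and stays within [e] of it. *)
  have [r] := @rat_in_itvoo R 0 (e / 2) ltac:(lra).
  rewrite in_itv /= => /andP[r0 re].
  have [p] := @rat_in_itvoo R (x - ratr r) x ltac:(lra).
  rewrite in_itv /= => /andP[px1 px2].
  have [q] := @rat_in_itvoo R (y - ratr r) y ltac:(lra).
  rewrite in_itv /= => /andP[qy1 qy2].
  exists ((p, q), r); last first.
    by split; rewrite /= /ball /= distrC ger0_norm; lra.
  move=> [u v] [/= pu qv]; apply: xyO; split; rewrite /=.
    have -> : e = e / 2 + e / 2 by lra.
    apply: (@ball_triangle R R (ratr p)).
      by rewrite /ball /= ger0_norm; lra.
    by apply: le_ball pu; exact: ltW.
  have -> : e = e / 2 + e / 2 by lra.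
  apply: (@ball_triangle R R (ratr q)).
    by rewrite /ball /= ger0_norm; lra.
  by apply: le_ball qv; exact: ltW.
rewrite bigcup_mkcond; apply: countable_bigcupT_measurable => [|q].
  exact: countableP.
case: ifPn => // _; by apply: measurableX; apply: measurable_ball.
Qed.

Lemma continuous_prod_measurable_fun (R : realType) (f : R * R -> R) :
  continuous f -> measurable_fun setT f.
Proof.
move=> /continuousP cf; apply: (measurability _ (RGenOpens.measurableE R)).
move=> _ [_ [a [b ->] <-]]; rewrite setTI; apply: open_prod_measurable.
exact/cf/interval_open.
Qed.

Section Fubini_Rintegral.
Context d1 d2 (T1 : measurableType d1) (T2 : measurableType d2) (R : realType).
Variables (m1 : {sigma_finite_measure set T1 -> \bar R}).
Variables (m2 : {sigma_finite_measure set T2 -> \bar R}).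
Implicit Types F : T1 * T2 -> R.

(** The real-valued inner integral is [fine] of the extended one; the two agree for almost every
    [x], namely where the section of [F] is integrable. *)
Lemma Rintegral12_prod_meas F : (m1 \x m2)%E.-integrable setT (EFin \o F) ->
  \int[(m1 \x m2)%E]_z F z = \int[m1]_x \int[m2]_y F (x, y).
Proof.
move=> iF; rewrite /Rintegral -integral12_prod_meas1//; congr fine.
have mF := measurable_fubini_F iF.
apply: ae_eq_integral => //.
  by apply/measurable_EFinP; exact: measurableT_comp mF.
have := ae_integrable1 iF; apply: filterS => x ix _.
by rewrite /fubini_F /= fineK// integrable_fin_num.
Qed.

Lemma Rintegral21_prod_meas F : (m1 \x m2)%E.-integrable setT (EFin \o F) ->
  \int[(m1 \x m2)%E]_z F z = \int[m2]_y \int[m1]_x F (x, y).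
Proof.
move=> iF; rewrite /Rintegral -integral21_prod_meas1//; congr fine.
have mF := measurable_fubini_G iF.
apply: ae_eq_integral => //.
  by apply/measurable_EFinP; exact: measurableT_comp mF.
have := ae_integrable2 iF; apply: filterS => x ix _.
by rewrite /fubini_G /= fineK// integrable_fin_num.
Qed.

(** Sections need not be integrable here: the extended inner integral is the difference of those of
    the positive and negative parts, each measurable by Tonelli's theorem, and [fine] preserves
    measurability. *)
Lemma measurable_Rintegral_section F : measurable_fun setT F ->
  measurable_fun setT (fun x => \int[m2]_y F (x, y)).
Proof.
move=> /measurable_EFinP mF; apply: measurableT_comp => //.
rewrite (_ : (fun _ => _) = fun x => (fubini_F m2 (EFin \o F)^\+ x -
    fubini_F m2 (EFin \o F)^\- x)%E).
  by apply: emeasurable_funB; apply: measurable_fun_fubini_tonelli_F => //;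
    [exact: measurable_funepos|exact: measurable_funeneg].
apply/funext => x; rewrite [LHS]integralE /fubini_F; congr (_ - _)%E;
  by apply: eq_integral => y _; rewrite ?funeposE ?funenegE.
Qed.

End Fubini_Rintegral.

Section swap.
Context {R : realType}.
Implicit Types F : R * R -> R.

(** Integrability is finiteness of either iterated integral of [|F|], and the swap turns one into
    the other. *)
Lemma integrable_swap F : (leb2 R).-integrable setT (EFin \o F) ->
  (leb2 R).-integrable setT (EFin \o (F \o swap_pair)).
Proof.
move=> iF; have mF : measurable_fun setT (EFin \o F) := measurable_int _ iF.
apply: (proj2 (@integrable21ltyP _ _ _ _ R (leb1 R) (leb1 R) _ _)).
  exact: (measurableT_comp mF (@measurable_swap _ _ R R)).
exact: ((integrable12ltyP (leb1 R) (leb1 R) mF).1 iF).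
Qed.

Lemma Rintegral_swap F : (leb2 R).-integrable setT (EFin \o F) ->
  \int[leb2 R]_z F (swap_pair z) = \int[leb2 R]_z F z.
Proof.
move=> iF; rewrite (Rintegral12_prod_meas iF) Rintegral21_prod_meas//.
exact: integrable_swap.
Qed.

End swap.

(** * Primitives along a line *)

Lemma compact_support_bounded (T : topologicalType) (R : realType) (K : set T)
    (f : T -> R) : compact K -> continuous f -> (forall x, ~ K x -> f x = 0) ->
  exists B, forall x, `|f x| <= B.
Proof.
move=> cK cf f0; have cfK : compact (f @` K).
  by apply: continuous_compact => //; exact: continuous_subspaceT.
have [M [_ fM]] := compact_bounded cfK.
exists (`|M| + 1) => x; have [Kx|/f0 ->] := pselect (K x); last first.
  by rewrite normr0 addr_ge0.
by apply: (fM (`|M| + 1)); [rewrite (le_lt_trans (ler_norm M))// ltrDl|exists x].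
Qed.

Lemma integrable_bounded_mull d (T : measurableType d) (R : realType)
    (mu : {measure set T -> \bar R}) (D : set T) (h g : T -> R) (B : R) :
  mu.-integrable D (EFin \o g) ->
  measurable D -> measurable_fun D h -> (forall x, `|h x| <= B) ->
  mu.-integrable D (EFin \o fun x => h x * g x).
Proof.
move=> ig mD mh hB; have mg : measurable_fun D g.
  by apply/measurable_EFinP; exact: measurable_int ig.
apply: (@le_integrable _ _ _ mu D mD _ (fun x => B%:E * (g x)%:E)%E) => //.
- by apply/measurable_EFinP; exact: measurable_funM.
- move=> x _ /=; rewrite lee_fin normrM [leRHS]normrM ler_wpM2r//.
  by rewrite (le_trans (hB x))// ler_norm.
- exact: integrableZl.
Qed.

(** By Tonelli's theorem the integral of [|g x * h y|] is the product of the two L^1 norms. *)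
Lemma integrable_tensor d1 d2 (T1 : measurableType d1) (T2 : measurableType d2)
    (R : realType) (m1 : {sigma_finite_measure set T1 -> \bar R})
    (m2 : {sigma_finite_measure set T2 -> \bar R}) (g : T1 -> R) (h : T2 -> R) :
  m1.-integrable setT (EFin \o g) -> m2.-integrable setT (EFin \o h) ->
  (m1 \x m2)%E.-integrable setT (EFin \o fun z => g z.1 * h z.2).
Proof.
move=> ig ih.
have mg : measurable_fun setT g.
  by apply/measurable_EFinP; exact: measurable_int ig.
have mh : measurable_fun setT h.
  by apply/measurable_EFinP; exact: measurable_int ih.
apply/integrable12ltyP.
  apply/measurable_EFinP; apply: measurable_funM; exact: measurableT_comp.
move/integrableP : (ig) => [_ ig'].
have ih' := integrable_fin_num measurableT (integrable_abse ih).
have mh' : measurable_fun setT (fun y => `|(h y)%:E|%E).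
  by apply: measurableT_comp => //; exact/measurable_EFinP.
have mg' : measurable_fun setT (fun y => `|(g y)%:E|%E).
  by apply: measurableT_comp => //; exact/measurable_EFinP.
rewrite (_ : (\int[m1]_x _)%E =
    (\int[m1]_x (`|(g x)%:E| * \int[m2]_y `|(h y)%:E|))%E); last first.
  apply: eq_integral => x _; rewrite -ge0_integralZl//.
  by apply: eq_integral => y _; rewrite /= normrM EFinM.
rewrite ge0_integralZr//.
- by rewrite muleC lte_mul_pinfty//; exact: integral_ge0.
- exact: integral_ge0.
Qed.

Section line_primitive.
Context {R : realType}.
Implicit Types (h D psi : R -> R) (c x s M : R).

Definition line_primitive c h x : R :=
  \int[leb1 R]_(s in `]-oo, x]) h s - c * \int[leb1 R]_s h s.

(** The integral kernel of [line_primitive c]. It takes only the values [1 - c] and [- c], so its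
    absolute value is at most 1 for [c = 0] and at most 1/2 for [c = 1/2]. *)
Definition line_kernel c x s : R := (s <= x)%R%:R - c.

Lemma normr_line_kernel c x s : `|line_kernel c x s| <= Num.max `|c| `|1 - c|.
Proof.
by rewrite /line_kernel le_max; case: (leP s x) => _; rewrite ?sub0r ?normrN lexx ?orbT.
Qed.

Lemma measurable_line_kernel c :
  measurable_fun setT (fun z : R * R => line_kernel c z.1 z.2).
Proof.
rewrite /line_kernel; apply: measurable_funB => //.
rewrite (_ : (fun _ => _) = fun z : R * R => if z.2 <= z.1 then 1 else 0).
  by apply: measurable_fun_ifT => //; exact: measurable_fun_ler.
by apply/funext => z; case: ifP.
Qed.

Lemma line_primitiveE c h x : (leb1 R).-integrable setT (EFin \o h) ->
  line_primitive c h x = \int[leb1 R]_s (line_kernel c x s * h s).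
Proof.
move=> ih; rewrite /line_primitive Rintegral_mkcond -RintegralZl// -RintegralB//.
- apply: eq_Rintegral => s _; rewrite /line_kernel mulrBl patchE; congr (_ - _).
  have -> : (s \in [set` `]-oo, x]]) = (s <= x) by rewrite mem_setE in_itv.
  by case: leP; rewrite ?mul1r ?mul0r.
- rewrite -restrict_EFin; apply/(integrable_mkcond _ _).1 => //.
  exact: integrableS ih.
- exact: (integrableZl measurableT c ih).
Qed.

Lemma normr_line_primitive c h x : (leb1 R).-integrable setT (EFin \o h) ->
  `|line_primitive c h x| <=
    Num.max `|c| `|1 - c| * \int[leb1 R]_s `|h s|.
Proof.
move=> ih; rewrite line_primitiveE//.
have mk : measurable_fun setT (line_kernel c x).
  exact: measurableT_comp (measurable_line_kernel c) (pair1_measurable x).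
have ikh := integrable_bounded_mull ih measurableT mk (normr_line_kernel c x).
rewrite (le_trans (le_normr_Rintegral _ _))//.
have inh : (leb1 R).-integrable setT (fun s => (`|h s|)%:E).
  exact: (integrable_norm ih).
rewrite -RintegralZl//.
apply: le_Rintegral => //.
- exact: (integrable_norm ikh).
- exact: (integrableZl measurableT _ inh).
- by move=> s _; rewrite normrM ler_wpM2r// normr_line_kernel.
Qed.

Lemma line_primitiveZ c h N x : (leb1 R).-integrable setT (EFin \o h) ->
  line_primitive c (fun s => N * h s) x = N * line_primitive c h x.
Proof.
move=> ih; rewrite /line_primitive !RintegralZl//; first by rewrite mulrBr mulrCA.
exact: integrableS ih.
Qed.

Lemma integrable_continuous_support D M : continuous D ->
  (forall x, M < `|x| -> D x = 0) -> (leb1 R).-integrable setT (EFin \o D).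
Proof.
move=> cD D0.
have -> : EFin \o D = (EFin \o D) \_ `[- M, M].
  apply/funext => x; rewrite patchE mem_setE in_itv /= -ler_norml.
  by case: leP => //= /D0 ->.
apply/(integrable_mkcond _ _).1 => //.
apply: continuous_compact_integrable; first exact: segment_compact.
exact: continuous_subspaceT.
Qed.

Lemma is_derive_continuous psi D :
  (forall x : R, is_derive x 1 psi (D x)) -> continuous psi.
Proof.
move=> dpsi x; apply: differentiable_continuous.
by apply/derivable1_diffP; apply: ex_derive.
Qed.

(** Beyond the support nothing contributes, so the integral reduces to a segment [[s, b]] with
    [psi b = 0], where the fundamental theorem of calculus applies. *)
Lemma Rintegral_derive_tail psi D M s : continuous D ->
  (forall x : R, is_derive x 1 psi (D x)) ->
  (forall x, M < `|x| -> psi x = 0) -> (forall x, M < `|x| -> D x = 0) ->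
  \int[leb1 R]_(x in `[s, +oo[) D x = - psi s.
Proof.
move=> cD dpsi psi0 D0; pose b := Num.max s M + 1.
have [sb Mb] : s < b /\ M < b.
  by split; rewrite /b -ltrBlDr lt_max; apply/orP; [left|right]; lra.
have cpsi := is_derive_continuous dpsi.
have -> : \int[leb1 R]_(x in `[s, +oo[) D x = \int[leb1 R]_(x in `[s, b]) D x.
  rewrite Rintegral_mkcond [RHS]Rintegral_mkcond; apply: eq_Rintegral => x _.
  rewrite !patchE !mem_setE !in_itv /= andbT.
  case: (leP s x) => //= sx; case: leP => // bx; apply: D0.
  by rewrite (lt_trans Mb)// (lt_le_trans bx)// ler_norm.
rewrite /Rintegral (@continuous_FTC2 _ D psi s b)//=.
- by rewrite (psi0 b) ?add0r// (lt_le_trans Mb)// ler_norm.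
- exact: continuous_subspaceT.
- split.
  + by move=> x _; exact: ex_derive.
  + exact/cvg_at_right_filter/cpsi.
  + exact/cvg_at_left_filter/cpsi.
- by move=> x _; rewrite derive1E derive_val.
Qed.

(** This is the tail formula started at a point [a] to the left of the support, where
    [psi a = 0]. *)
Lemma Rintegral_derive psi D M : continuous D ->
  (forall x : R, is_derive x 1 psi (D x)) ->
  (forall x, M < `|x| -> psi x = 0) -> (forall x, M < `|x| -> D x = 0) ->
  \int[leb1 R]_x D x = 0.
Proof.
move=> cD dpsi psi0 D0; pose a := - (`|M| + 1).
have Ma x : x <= a -> M < `|x|.
  move=> xa; have := ler_norm M; have := ler_norm (- x).
  by rewrite normrN /a in xa *; lra.
have := Rintegral_derive_tail a cD dpsi psi0 D0.
rewrite (psi0 a) ?Ma// oppr0 => <-; rewrite [RHS]Rintegral_mkcond.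
apply: eq_Rintegral => x _; rewrite patchE mem_setE in_itv /= andbT.
by case: leP => // /ltW/Ma/D0.
Qed.

(** Fubini's theorem for [line_kernel c x s * D x * h s]: for fixed [s], integrating the kernel
    against [D] gives the tail integral [- psi s] minus [c] times the total integral of [D], which
    vanishes. *)
Lemma Rintegral_line_primitive_derive c h psi D M :
  (leb1 R).-integrable setT (EFin \o h) -> continuous D ->
  (forall x : R, is_derive x 1 psi (D x)) ->
  (forall x, M < `|x| -> psi x = 0) -> (forall x, M < `|x| -> D x = 0) ->
  \int[leb1 R]_x (line_primitive c h x * D x) =
  - \int[leb1 R]_s (h s * psi s).
Proof.
move=> ih cD dpsi psi0 D0.
have iD := integrable_continuous_support cD D0.
have cpsi := is_derive_continuous dpsi.
have iF : (leb2 R).-integrable setT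
    (EFin \o fun z => line_kernel c z.1 z.2 * (D z.1 * h z.2)).
  exact: (integrable_bounded_mull (integrable_tensor iD ih) measurableT
    (measurable_line_kernel c) (fun z => normr_line_kernel c z.1 z.2)).
have mk x : measurable_fun setT (line_kernel c x).
  exact: measurableT_comp (measurable_line_kernel c) (pair1_measurable x).
have mk' s : measurable_fun setT (line_kernel c ^~ s).
  exact: measurableT_comp (measurable_line_kernel c) (pair2_measurable s).
transitivity (\int[leb2 R]_z (line_kernel c z.1 z.2 * (D z.1 * h z.2))).
  rewrite (Rintegral12_prod_meas iF); apply: eq_Rintegral => x _ /=.
  rewrite line_primitiveE// -RintegralZr//.
    by apply: eq_Rintegral => s _; rewrite -mulrA (mulrC (h s)).
  exact: (integrable_bounded_mull ih measurableT (mk x) (normr_line_kernel c x)).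
rewrite (Rintegral21_prod_meas iF) /= -mulN1r -RintegralZl//; last first.
  have [B psiB] : exists B, forall x, `|psi x| <= B.
    apply: (@compact_support_bounded _ _ `[- M, M]) => //.
      exact: segment_compact.
    move=> x /negP; rewrite in_itv /= -ler_norml -ltNge; exact: psi0.
  have mpsi : measurable_fun setT psi by exact: continuous_measurable_fun.
  have := integrable_bounded_mull ih measurableT mpsi psiB.
  by apply: eq_integrable => // s _ /=; rewrite mulrC.
apply: eq_Rintegral => s _; rewrite mulN1r.
have ikD := integrable_bounded_mull iD measurableT (mk' s)
  (fun x => normr_line_kernel c x s).
transitivity ((\int[leb1 R]_x (line_kernel c x s * D x)) * h s).
  by rewrite -RintegralZr//; apply: eq_Rintegral => x _; rewrite mulrA.
rewrite mulrC -mulrN; congr (_ * _).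
rewrite -(Rintegral_derive_tail s cD dpsi psi0 D0).
(* The zero term [c * \int D] is inserted so that both parts of the kernel appear on the right. *)
rewrite -[RHS]subr0 -[X in _ = _ - X](mulr0 c).
rewrite -(Rintegral_derive cD dpsi psi0 D0) -RintegralZl//.
rewrite [X in _ = X - _]Rintegral_mkcond -RintegralB//.
- apply: eq_Rintegral => x _; rewrite /line_kernel mulrBl patchE; congr (_ - _).
  rewrite mem_setE in_itv /= andbT.
  by case: leP; rewrite ?mul1r ?mul0r.
- rewrite -restrict_EFin; apply/(integrable_mkcond _ _).1 => //.
  exact: integrableS iD.
- exact: (integrableZl measurableT c iD).
Qed.

End line_primitive.

(** * Primitives along rows and columns *)

Section plane_primitives.
Context {R : realType}.
Implicit Types (f g D phi : R * R -> R) (B M c : R).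

Definition hprimitive c f (z : R * R) : R := line_primitive c (fun s => f (s, z.2)) z.1.

Definition vprimitive c f (z : R * R) : R :=
  line_primitive c (fun s => f (z.1, s)) z.2.

(** Exchanging the coordinates reduces every statement about columns to the one about rows. *)
Lemma vprimitiveE c f :
  vprimitive c f = hprimitive c (f \o swap_pair) \o swap_pair.
Proof. by []. Qed.

Lemma square_measure_lty M : (leb2 R (square M) < +oo)%E.
Proof.
rewrite /square product_measure1E; [|exact: measurable_itv..].
have fin : (leb1 R `[(- M)%R, M] < +oo)%E.
  by rewrite lebesgue_measure_itv /=; case: ifP => _; rewrite -?EFinB ltry.
by apply: lte_mul_pinfty => //; rewrite ge0_fin_numE.
Qed.

(** The norm on [R * R] is the maximum norm, so its closed balls about the origin are squares. *)
Lemma squareP M (z : R * R) : square M z <-> `|z| <= M.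
Proof.
rewrite /square prod_normE ge_max !ler_norml /= !in_itv /=.
by split => [[-> ->]|/andP[]].
Qed.

Lemma compact_square M : compact (square M).
Proof. by apply: compact_setX; exact: segment_compact. Qed.

Lemma square_support_bounded phi M : continuous phi ->
  (forall z : R * R, M < `|z| -> phi z = 0) -> exists B, forall z, `|phi z| <= B.
Proof.
move=> cphi phi0; apply: (@compact_support_bounded _ R _ phi (@compact_square M) cphi) => z.
by move=> Mz; apply: phi0; rewrite ltNge; apply/negP => /squareP.
Qed.

Lemma square_support_integrable phi M : continuous phi ->
  (forall z : R * R, M < `|z| -> phi z = 0) ->
  (leb2 R).-integrable setT (EFin \o phi).
Proof.
move=> cphi phi0; have [B phiB] := square_support_bounded cphi phi0.
have msq : measurable (square M : set (measurableTypeR R * measurableTypeR R)).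
  by apply: measurableX; exact: measurable_itv.
have -> : EFin \o phi = (EFin \o phi) \_ (square M).
  apply/funext => z; rewrite patchE; case: ifPn => //= zM.
  rewrite phi0// ltNge; apply/negP => /squareP Mz.
  by move: zM; rewrite mem_set.
apply/(integrable_mkcond _ _).1 => //.
apply: measurable_bounded_integrable => //.
- exact: square_measure_lty.
- by apply: measurable_funS (continuous_prod_measurable_fun cphi).
- exists B; split; first exact: num_real.
  by move=> x Bx z _; exact: le_trans (phiB z) (ltW Bx).
Qed.

Lemma continuous_row D (y : R) :
  continuous D -> continuous (fun x : R => D (x, y)).
Proof.
move=> cD x; have cp : (pair^~ y) t @[t --> x] --> ((x, y) : R * R).
  exact: (cvg_pair (G := nbhs x) (H := nbhs y) cvg_id (cvg_cst y)).
exact: (cvg_comp _ D cp (cD (x, y))).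
Qed.

Section bounded_rows.
Variables (c B : R) (f : R * R -> R).
Hypotheses (mf : measurable_fun setT f).
Hypothesis fB : forall y, (\int[leb1 R]_s `|f (s, y)|%:E <= B%:E)%E.

Lemma row_integrable y : (leb1 R).-integrable setT (EFin \o fun s => f (s, y)).
Proof.
apply/integrableP; split; last by rewrite (le_lt_trans (fB y))// ltry.
by apply/measurable_EFinP; exact: measurableT_comp mf (pair2_measurable y).
Qed.

(** The kernel form makes this a parametric integral whose integrand is jointly measurable in the
    point of the plane and the integration variable. *)
Lemma measurable_hprimitive : measurable_fun setT (hprimitive c f).
Proof.
rewrite (_ : hprimitive c f = fun z : R * R =>
    \int[leb1 R]_s (line_kernel c z.1 s * f (s, z.2))).
  apply: (measurable_Rintegral_section (leb1 R)
    (F := fun w : (R * R) * R => line_kernel c w.1.1 w.2 * f (w.2, w.1.2))).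
  have m12 : measurable_fun setT (fun w : (R * R) * R => (w.1.1, w.2)).
    by apply/measurable_fun_pairP; split;
      [exact: (measurableT_comp measurable_fst measurable_fst)|exact: measurable_snd].
  have m21 : measurable_fun setT (fun w : (R * R) * R => (w.2, w.1.2)).
    by apply/measurable_fun_pairP; split;
      [exact: measurable_snd|exact: (measurableT_comp measurable_snd measurable_fst)].
  apply: measurable_funM.
    exact: measurableT_comp (measurable_line_kernel c) m12.
  exact: measurableT_comp mf m21.
apply/funext => z; rewrite /hprimitive line_primitiveE//.
exact: row_integrable.
Qed.

Lemma normr_hprimitive z :
  `|hprimitive c f z| <= Num.max `|c| `|1 - c| * B.
Proof.
rewrite (le_trans (normr_line_primitive _ _ _))//; first exact: row_integrable.
rewrite ler_wpM2l// ?le_max ?normr_ge0// -lee_fin /Rintegral fineK ?fB//.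
exact: integrable_fin_num (integrable_norm (row_integrable z.2)).
Qed.

Variables (M : R) (phi D : R * R -> R).
Hypotheses (intf : (leb2 R).-integrable setT (EFin \o f)).
Hypotheses (cphi : continuous phi) (cD : continuous D).
Hypothesis dphi : forall x y : R, is_derive x 1 (fun s => phi (s, y)) (D (x, y)).
Hypotheses (phi0 : forall z : R * R, M < `|z| -> phi z = 0)
  (D0 : forall z : R * R, M < `|z| -> D z = 0).

Lemma integrable_hprimitive_mul :
  (leb2 R).-integrable setT (EFin \o fun z => hprimitive c f z * D z).
Proof.
apply: (integrable_bounded_mull (square_support_integrable cD D0) measurableT
  measurable_hprimitive normr_hprimitive).
Qed.

Lemma integrable_mul_test :
  (leb2 R).-integrable setT (EFin \o fun z => f z * phi z).
Proof.
have [K phiK] := square_support_bounded cphi phi0.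
have := integrable_bounded_mull intf measurableT
  (continuous_prod_measurable_fun cphi) phiK.
by apply: eq_integrable => // z _ /=; rewrite mulrC.
Qed.

(** Fubini's theorem cuts both integrals into rows, where the one-dimensional identity applies. *)
Lemma Rintegral_hprimitive_mul :
  \int[leb2 R]_z (hprimitive c f z * D z) = - \int[leb2 R]_z (f z * phi z).
Proof.
rewrite (Rintegral21_prod_meas integrable_hprimitive_mul).
have iN : (leb2 R).-integrable setT (EFin \o fun z => -1 * (f z * phi z)).
  exact: (integrableZl measurableT (-1) integrable_mul_test).
rewrite -mulN1r -(RintegralZl _ measurableT integrable_mul_test).
rewrite (Rintegral21_prod_meas iN); apply: eq_Rintegral => y _.
transitivity (- \int[leb1 R]_s (f (s, y) * phi (s, y))); last first.
  rewrite -[LHS]mulN1r -RintegralZl//.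
  have [K phiK] := square_support_bounded cphi phi0.
  have := integrable_bounded_mull (row_integrable y) measurableT
    (measurable_fun_pair1 y (continuous_prod_measurable_fun cphi))
    (fun s => phiK (s, y)).
  by apply: eq_integrable => // s _ /=; rewrite mulrC.
have le_norm (x : R) : `|x| <= `|((x, y) : R * R)|.
  by rewrite prod_normE le_max lexx.
apply: (@Rintegral_line_primitive_derive R c (fun s => f (s, y))
  (fun s => phi (s, y)) (fun x => D (x, y)) M).
- exact: row_integrable.
- exact: continuous_row.
- by move=> x Mx; apply: phi0; exact: lt_le_trans (le_norm x).
- by move=> x Mx; apply: D0; exact: lt_le_trans (le_norm x).
Qed.

End bounded_rows.

Lemma norm_swap_pair (z : R * R) : `|(swap_pair z : R * R)| = `|z|.
Proof. by rewrite !prod_normE maxC. Qed.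

(** The difference quotients of [phi] in the direction [(1, 0)] are those of its restriction to the
    row, so existence and value of the derivative carry over. *)
Lemma is_derive_horizontal phi (x y : R) :
  derivable phi (x, y) ((1, 0) : R * R) ->
  is_derive x 1 (fun s => phi (s, y)) (dx phi (x, y)).
Proof.
have E : (fun h : R => h^-1 *: ((phi \o shift (x, y)) (h *: ((1, 0) : R * R))
      - phi (x, y))) =
    (fun h : R => h^-1 *: (((fun s => phi (s, y)) \o shift x) (h *: 1)
      - phi (x, y))).
  apply/funext => h /=; congr (_ *: (phi _ - _)).
  by congr pair; rewrite /= scaler0 add0r.
by move=> d; apply: DeriveDef; rewrite ?/dx ?/derive /derivable -?E.
Qed.

Lemma is_derive_vertical phi (x y : R) :
  derivable phi (x, y) ((0, 1) : R * R) ->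
  is_derive y 1 (fun s => phi (x, s)) (dy phi (x, y)).
Proof.
have E : (fun h : R => h^-1 *: ((phi \o shift (x, y)) (h *: ((0, 1) : R * R))
      - phi (x, y))) =
    (fun h : R => h^-1 *: (((fun s => phi (x, s)) \o shift y) (h *: 1)
      - phi (x, y))).
  apply/funext => h /=; congr (_ *: (phi _ - _)).
  by congr pair; rewrite /= scaler0 add0r.
by move=> d; apply: DeriveDef; rewrite ?/dy ?/derive /derivable -?E.
Qed.

(** The exterior of a closed ball is open, so [phi] vanishes in a neighbourhood of [z]. *)
Lemma derive_outside_ball phi M (v z : R * R) :
  (forall w : R * R, M < `|w| -> phi w = 0) -> M < `|z| -> 'D_v phi z = 0.
Proof.
move=> phi0 Mz; rewrite (@near_eq_derive _ _ _ phi (cst 0)) ?derive_cst//.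
have nz : `|w : R * R| @[w --> z] --> `|z| by exact: norm_continuous.
exact: filterS phi0 (cvgr_gt _ nz _ Mz).
Qed.

Lemma test_function_support phi : test_function phi ->
  exists M, forall z : R * R, M < `|z| -> phi z = 0.
Proof.
move=> [_ /compact_bounded[M [_ phiM]]]; exists (M + 1) => z Mz.
apply: contrapT => /eqP phiz; have /phiM : M < M + 1 by rewrite ltrDl.
have cz : closure [set z | phi z != 0] z by exact: subset_closure.
by move=> /(_ z cz) /=; rewrite leNgt Mz.
Qed.

(** * Divergence of the field with both components *)

Section field.
Variables (c B : R) (f1 f2 : R * R -> R).
Hypotheses (mf1 : measurable_fun setT f1) (mf2 : measurable_fun setT f2).
Hypothesis f1B : forall y, (\int[leb1 R]_s `|f1 (s, y)|%:E <= B%:E)%E.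
Hypothesis f2B : forall x, (\int[leb1 R]_s `|f2 (x, s)|%:E <= B%:E)%E.

Lemma measurable_vprimitive : measurable_fun setT (vprimitive c f2).
Proof.
rewrite vprimitiveE.
apply: (measurableT_comp (measurable_hprimitive c (B := B) _ f2B)).
  exact: (measurableT_comp mf2 (@measurable_swap _ _ R R)).
exact: measurable_swap.
Qed.

Lemma normr_vprimitive z :
  `|vprimitive c f2 z| <= Num.max `|c| `|1 - c| * B.
Proof.
rewrite vprimitiveE; apply: normr_hprimitive f2B _.
exact: (measurableT_comp mf2 (@measurable_swap _ _ R R)).
Qed.

Hypotheses (if1 : (leb2 R).-integrable setT (EFin \o f1))
  (if2 : (leb2 R).-integrable setT (EFin \o f2)).

(** The first component is tested against [dx phi] only and the second against [dy phi] only, so the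
    row identity handles [f1] and, in swapped coordinates, [f2]. *)
Lemma distributional_div_primitives :
  distributional_div (fun z => (hprimitive c f1 z, vprimitive c f2 z))
    (fun z => f1 z + f2 z).
Proof.
move=> phi tphi; have [M phi0] := test_function_support tphi.
have [/(_ 1%N)[cphi [dphix dphiy [cdx _] [cdy _]]] _] := tphi.
have dx0 z : M < `|z| -> dx phi z = 0 by exact: derive_outside_ball.
have dy0 z : M < `|z| -> dy phi z = 0 by exact: derive_outside_ball.
have mf2s : measurable_fun setT (f2 \o swap_pair).
  exact: (measurableT_comp mf2 (@measurable_swap _ _ R R)).
have cphis : continuous (phi \o swap_pair).
  by move=> z; apply: continuous_comp; [exact: swap_continuous|exact: cphi].
have cdys : continuous (dy phi \o swap_pair).
  by move=> z; apply: continuous_comp; [exact: swap_continuous|exact: cdy].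
have phis0 z : M < `|z| -> (phi \o swap_pair) z = 0.
  by rewrite -norm_swap_pair; exact: phi0.
have dys0 z : M < `|z| -> (dy phi \o swap_pair) z = 0.
  by rewrite -norm_swap_pair; exact: dy0.
have ip1 := integrable_hprimitive_mul c mf1 f1B cdx dx0.
have ip2s := integrable_hprimitive_mul c mf2s f2B cdys dys0.
have ip2 : (leb2 R).-integrable setT
    (EFin \o fun z => vprimitive c f2 z * dy phi z).
  have := integrable_swap ip2s.
  by apply: eq_integrable => // -[x y] _ /=.
have it1 := integrable_mul_test if1 cphi phi0.
have it2 := integrable_mul_test if2 cphi phi0.
rewrite RintegralD//.
under [in RHS]eq_Rintegral do rewrite mulrDl.
rewrite RintegralD// opprD; congr (_ + _).
  exact: (Rintegral_hprimitive_mul c mf1 f1B if1 cphi cdx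
    (fun x y => is_derive_horizontal (dphix (x, y))) phi0 dx0).
rewrite -(Rintegral_swap it2) -(Rintegral_swap ip2).
exact: (Rintegral_hprimitive_mul c mf2s f2B (integrable_swap if2) cphis cdys
  (fun x y => is_derive_vertical (dphiy (y, x))) phis0 dys0).
Qed.

End field.

End plane_primitives.

(** * The splitting algorithm *)

(** On its strict superlevel set, [g] dominates the constant [t]. *)
Lemma markov_lt d (T : measurableType d) (R : realType)
    (mu : {measure set T -> \bar R}) (g : T -> \bar R) (t : R) :
  0 < t -> measurable_fun setT g -> (forall x, 0 <= g x)%E ->
  (t%:E * mu [set x | (t%:E < g x)%E] <= \int[mu]_x g x)%E.
Proof.
move=> t0 mg g0; set S := [set x | _].
have mS : measurable S by rewrite -[S]setTI; exact: measurable_lte.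
rewrite -integral_cst//; apply: (@le_trans _ _ (\int[mu]_(x in S) g x)%E).
  apply: ge0_le_integral => //.
  - by move=> x _; rewrite lee_fin ltW.
  - exact: measurable_funS mg.
  - by move=> x /ltW.
exact: ge0_subset_integral.
Qed.

Lemma le_geometric_eq0 (R : realType) (a : R) (z : R) (x : \bar R) :
  `|z| < 1 -> (0 <= x)%E -> (forall k, x <= (a * z ^+ k)%:E)%E -> x = 0%E.
Proof.
move=> z1 x0 xk; apply/eqP; rewrite eq_le x0 andbT.
apply/lee_addgt0Pr => e e0; rewrite add0e.
have [k _ /(_ k (leqnn k)) ke] := cvgr_lt _ (cvg_geometric a z1) _ e0.
by rewrite (le_trans (xk k))// lee_fin ltW.
Qed.

Section splitting.
Context {R : realType}.
Variables (tau : R) (Omega : set (R * R)) (f : R * R -> R).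
Implicit Types (A : set (R * R)) (x y : R) (k : nat).

Local Notation stage := (stage tau Omega f).
Local Notation residual := (residual tau Omega f).

(** Since vertical masses are those of [A] itself, the two directions are symmetric: a point
    survives exactly when both lines through it are heavy, that is, of mass above [tau]. *)
Lemma nextE A : Defs.next tau f A =
  A `&` [set z | (tau%:E < hmass f A z.2)%E /\ (tau%:E < vmass f A z.1)%E].
Proof.
apply/seteqP; split=> z; rewrite /Defs.next /hpart /vpart /=.
  move=> [Az /not_orP[nh nv]]; split => //.
  have hz : (tau%:E < hmass f A z.2)%E.
    by rewrite ltNge; apply/negP => ?; apply: nh.
  split=> //; rewrite ltNge; apply/negP => vz; apply: nv; split=> [|//].
  by split=> [//|[_]]; rewrite leNgt hz.
move=> [Az [hz vz]]; split=> [//|[[_]|[_]]]; first by rewrite leNgt hz.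
by rewrite leNgt vz.
Qed.

Lemma stageS k : stage k.+1 = Defs.next tau f (stage k).
Proof. by []. Qed.

Lemma stageS_hv k (z : R * R) : stage k.+1 z <-> [/\ stage k z,
  (tau%:E < hmass f (stage k) z.2)%E & (tau%:E < vmass f (stage k) z.1)%E].
Proof. by rewrite stageS nextE /=; split=> [[? []]|[]]. Qed.

Lemma stage_anti j k : (j <= k)%N -> stage k `<=` stage j.
Proof.
elim: k => [|k IH]; first by rewrite leqn0 => /eqP ->.
rewrite leq_eqVlt => /predU1P[->//|/IH jk] z /stageS_hv[/jk]; exact.
Qed.

Lemma stage_sub k : stage k `<=` Omega.
Proof. exact: (@stage_anti 0 k). Qed.

Hypothesis mO : measurable (Omega : set (measurableTypeR R * measurableTypeR R)).
Hypothesis mf : measurable_fun Omega f.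

Lemma measurable_patch A : measurable A -> A `<=` Omega ->
  measurable_fun setT (f \_ A).
Proof.
by move=> mA AO; apply/(measurable_restrictT _ _).1 => //; exact: measurable_funS mf.
Qed.

Lemma measurable_hmass A : measurable A -> A `<=` Omega ->
  measurable_fun setT (hmass f A).
Proof.
move=> mA AO; apply: (measurable_fun_fubini_tonelli_G (m1 := leb1 R)
  (fun z => `|(f \_ A) z|%:E)) => //.
by apply/measurable_EFinP; apply: measurableT_comp => //; exact: measurable_patch.
Qed.

Lemma measurable_vmass A : measurable A -> A `<=` Omega ->
  measurable_fun setT (vmass f A).
Proof.
move=> mA AO; apply: (measurable_fun_fubini_tonelli_F (m2 := leb1 R)
  (fun z => `|(f \_ A) z|%:E)) => //.
by apply/measurable_EFinP; apply: measurableT_comp => //; exact: measurable_patch.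
Qed.

Lemma hmass_ge0 A y : (0 <= hmass f A y)%E.
Proof. exact: integral_ge0. Qed.

Lemma vmass_ge0 A x : (0 <= vmass f A x)%E.
Proof. exact: integral_ge0. Qed.

(** Tonelli's theorem, integrating along each row first. *)
Lemma integral_hmass A : measurable A -> A `<=` Omega ->
  (\int[leb1 R]_y hmass f A y = \int[leb2 R]_(z in A) `|f z|%:E)%E.
Proof.
move=> mA AO; transitivity (\int[leb2 R]_z `|(f \_ A) z|%:E)%E.
  apply/esym; apply: (@fubini_tonelli2 _ _ _ _ R (leb1 R) (leb1 R)
    (fun z => `|(f \_ A) z|%:E)) => //.
  by apply/measurable_EFinP; apply: measurableT_comp => //;
    exact: measurable_patch.
rewrite [RHS]integral_mkcond; apply: eq_integral => z _.
by rewrite !patchE; case: ifPn => //; rewrite normr0.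
Qed.

Lemma integral_vmass A : measurable A -> A `<=` Omega ->
  (\int[leb1 R]_x vmass f A x = \int[leb2 R]_(z in A) `|f z|%:E)%E.
Proof.
move=> mA AO; transitivity (\int[leb2 R]_z `|(f \_ A) z|%:E)%E.
  apply/esym; apply: (@fubini_tonelli1 _ _ _ _ R (leb1 R) (leb1 R)
    (fun z => `|(f \_ A) z|%:E)) => //.
  by apply/measurable_EFinP; apply: measurableT_comp => //;
    exact: measurable_patch.
rewrite [RHS]integral_mkcond; apply: eq_integral => z _.
by rewrite !patchE; case: ifPn => //; rewrite normr0.
Qed.

Definition hlevel A : set R := [set y | (tau%:E < hmass f A y)%E].
Definition vlevel A : set R := [set x | (tau%:E < vmass f A x)%E].

Lemma measurable_hlevel A : measurable A -> A `<=` Omega ->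
  measurable (hlevel A : set (measurableTypeR R)).
Proof.
by move=> mA AO; rewrite -[hlevel A]setTI; apply: measurable_lte => //;
  exact: measurable_hmass.
Qed.

Lemma measurable_vlevel A : measurable A -> A `<=` Omega ->
  measurable (vlevel A : set (measurableTypeR R)).
Proof.
by move=> mA AO; rewrite -[vlevel A]setTI; apply: measurable_lte => //;
  exact: measurable_vmass.
Qed.

(** Expressed through a strip over the level set, the part has a measurability that can be read
    off. *)
Lemma hpartE A : hpart tau f A = A `\` (setT `*` hlevel A).
Proof.
apply/seteqP; split=> z; rewrite /hpart /hlevel /=.
  by move=> [Az hz]; split => // -[_]; rewrite ltNge hz.
by move=> [Az nz]; split => //; rewrite leNgt; apply/negP => hz; apply: nz.
Qed.

Lemma vpartE A : vpart tau f A = (A `&` (setT `*` hlevel A)) `\` (vlevel A `*` setT).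
Proof.
rewrite /vpart hpartE setDD; apply/seteqP; split=> z /= [Az vz]; split => //.
  by rewrite /vlevel /= => -[]; rewrite ltNge vz.
by rewrite leNgt; apply/negP => vz'; apply: vz.
Qed.

Lemma measurable_hpart A : measurable A -> A `<=` Omega ->
  measurable (hpart tau f A).
Proof.
move=> mA AO; rewrite hpartE; apply: measurableD => //; apply: measurableX => //.
exact: measurable_hlevel.
Qed.

Lemma measurable_vpart A : measurable A -> A `<=` Omega ->
  measurable (vpart tau f A).
Proof.
move=> mA AO; rewrite vpartE; apply: measurableD.
  apply: measurableI => //; apply: measurableX => //; exact: measurable_hlevel.
by apply: measurableX => //; exact: measurable_vlevel.
Qed.

Lemma measurable_stage k : measurable (stage k).
Proof.
elim: k => [//|k IH]; rewrite stageS /Defs.next; apply: measurableD => //.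
by apply: measurableU; [apply: measurable_hpart|apply: measurable_vpart] => //;
  exact: stage_sub.
Qed.

Lemma stageS_sub_levels k :
  stage k.+1 `<=` vlevel (stage k) `*` hlevel (stage k).
Proof. by move=> z /stageS_hv[_ ? ?]. Qed.

Lemma measurable_residual : measurable residual.
Proof. by apply: bigcapT_measurable => k; exact: measurable_stage. Qed.

Lemma measurable_Omega1 : measurable (Omega1 tau Omega f).
Proof.
apply: measurableU; last exact: measurable_residual.
apply: bigcupT_measurable => k; apply: measurable_hpart; last exact: stage_sub.
exact: measurable_stage.
Qed.

Lemma measurable_Omega2 : measurable (Omega2 tau Omega f).
Proof.
apply: bigcupT_measurable => k; apply: measurable_vpart; last exact: stage_sub.
exact: measurable_stage.
Qed.

(** A point of [Omega] outside the residual set has a last stage containing it; there one of its two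
    lines is light, which puts it into [Omega1] or [Omega2]. *)
Lemma Omega12U : Omega1 tau Omega f `|` Omega2 tau Omega f = Omega.
Proof.
apply/seteqP; split=> z.
  move=> [[[k _ [kz _]]|/(_ 0%N I)//]|[k _ [[kz _] _]]]; exact: (@stage_sub k).
move=> Oz; have [rz|nrz] := pselect (residual z); first by left; right.
have /existsNP[k /not_implyP[_ nk]] := nrz.
elim: k nk => [/(_ Oz)//|k IH nk].
have [kz|] := pselect (stage k z); last exact: IH.
have [hz|hz] := leP (hmass f (stage k) z.2) tau%:E.
  by left; left; exists k.
have [vz|vz] := leP (vmass f (stage k) z.1) tau%:E.
  right; exists k => //; split=> //; split=> // -[_].
  by rewrite leNgt hz.
by case: nk; apply/stageS_hv; split.
Qed.

Lemma Omega1_sub : Omega1 tau Omega f `<=` Omega.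
Proof. by rewrite -[X in _ `<=` X]Omega12U; exact: subsetUl. Qed.

Lemma Omega2_sub : Omega2 tau Omega f `<=` Omega.
Proof. by rewrite -[X in _ `<=` X]Omega12U; exact: subsetUr. Qed.

(** A point of a stage has heavy lines at all earlier stages, so it was not assigned before; within
    one stage [vpart] excludes [hpart], and residual points have heavy lines at every stage. *)
Lemma Omega12I : Omega1 tau Omega f `&` Omega2 tau Omega f = set0.
Proof.
apply/seteqP; split=> // z [] [[j _ [jz hj]]|rz] [k _ [[kz hk] vk]].
  have [jk|kj|jk] := ltngtP j k.
  - by have /stageS_hv[_] := stage_anti jk kz; rewrite ltNge hj.
  - by have /stageS_hv[_ _] := stage_anti kj jz; rewrite ltNge vk.
  - by apply: hk; rewrite -jk.
by have /stageS_hv[_ _] := rz k.+1 I; rewrite ltNge vk.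
Qed.

(** * Geometric decay of the stages and the bounds on rows and columns *)

Section decay.
Hypothesis tau_gt1 : 1 < tau.
Hypothesis Omega_fin : (leb2 R Omega < +oo)%E.
Hypothesis f_weak : forall E : set (R * R), measurable E -> E `<=` Omega ->
  (\int[leb2 R]_(z in E) `|f z|%:E <= (leb2 R E) `^ 2^-1)%E.

Let mass k : \bar R := (\int[leb2 R]_(z in stage k) `|f z|%:E)%E.
Let tau_gt0 : 0 < tau. Proof. exact: lt_trans tau_gt1. Qed.

(** Markov's inequality for the line masses, whose integral over all parallel lines is the mass of
    the stage. *)
Lemma levels_mass k (q : R) : (mass k <= q%:E)%E ->
  (leb1 R (hlevel (stage k)) <= (tau^-1 * q)%:E)%E /\
  (leb1 R (vlevel (stage k)) <= (tau^-1 * q)%:E)%E.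
Proof.
move=> kq; have mk := measurable_stage k; have sk := @stage_sub k.
split; rewrite EFinM lee_pdivlMl// (le_trans _ kq)//.
  rewrite /mass -integral_hmass//; apply: markov_lt => //.
    exact: measurable_hmass.
  by move=> y; exact: hmass_ge0.
rewrite /mass -integral_vmass//; apply: markov_lt => //.
  exact: measurable_vmass.
by move=> x; exact: vmass_ge0.
Qed.

(** The next stage lies in the rectangle of heavy abscissas and ordinates, whose area is at most the
    square of [tau^-1 * q]; the weak bound takes the square root of the area. *)
Lemma massS k (q : R) : 0 <= q -> (mass k <= q%:E)%E ->
  (mass k.+1 <= (tau^-1 * q)%:E)%E.
Proof.
move=> q0 kq; have mk := measurable_stage k; have sk := @stage_sub k.
have [hq vq] := levels_mass kq.
have tq0 : 0 <= tau^-1 * q by rewrite mulr_ge0// invr_ge0 ltW.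
apply: (le_trans (f_weak (measurable_stage k.+1) (@stage_sub k.+1))).
rewrite poweR12_sqrt//.
(* Writing the bound as a square root reduces the claim to a comparison of areas. *)
have -> : (tau^-1 * q)%:E = sqrte ((tau^-1 * q)%:E ^+ 2).
  by rewrite sqrte_sqr gee0_abs// lee_fin.
rewrite lee_sqrt ?sqre_ge0//.
apply: (@le_trans _ _ (leb2 R (vlevel (stage k) `*` hlevel (stage k)))).
  apply: le_measure; rewrite ?inE//; first exact: measurable_stage.
    by apply: measurableX; [exact: measurable_vlevel|exact: measurable_hlevel].
  exact: stageS_sub_levels.
rewrite product_measure1E; [|exact: measurable_vlevel|exact: measurable_hlevel].
by rewrite expe2 lee_pmul.
Qed.

Let m0 := fine (mass 0).

(** Iteration of [massS]; the initial mass is finite because [Omega] has finite measure. *)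
Lemma mass_decay k : (mass k <= (m0 * tau^-1 ^+ k)%:E)%E.
Proof.
elim: k => [|k IH].
  rewrite expr0 mulr1 /m0 fineK// ge0_fin_numE ?integral_ge0//.
  by rewrite (le_lt_trans (f_weak mO _))// poweR_lty.
rewrite exprS mulrCA; apply: massS => //.
rewrite mulr_ge0 ?exprn_ge0 ?invr_ge0 ?(ltW tau_gt0)// fine_ge0//.
exact: integral_ge0.
Qed.

Definition hlimit : set R := \bigcap_k hlevel (stage k).
Definition vlimit : set R := \bigcap_k vlevel (stage k).

Lemma measurable_hlimit : measurable (hlimit : set (measurableTypeR R)).
Proof.
apply: bigcapT_measurable => k; apply: measurable_hlevel; last exact: stage_sub.
exact: measurable_stage.
Qed.

Lemma measurable_vlimit : measurable (vlimit : set (measurableTypeR R)).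
Proof.
apply: bigcapT_measurable => k; apply: measurable_vlevel; last exact: stage_sub.
exact: measurable_stage.
Qed.

Let tauV_lt1 : `|tau^-1| < 1.
Proof. by rewrite ger0_norm ?invr_ge0 ?(ltW tau_gt0)// invf_lt1. Qed.

(** The limit set lies in every level set, and the measure of the [k]-th one is at most
    [tau^-1 * m0 * tau^-1 ^+ k]. *)
Lemma hlimit_null : leb1 R hlimit = 0%E.
Proof.
apply: (le_geometric_eq0 (a := tau^-1 * m0) tauV_lt1) => // k.
rewrite -mulrA; apply: le_trans (levels_mass (mass_decay k)).1.
apply: le_measure; rewrite ?inE; first exact: measurable_hlimit.
  apply: measurable_hlevel; last exact: stage_sub.
  exact: measurable_stage.
by move=> y; apply.
Qed.

Lemma vlimit_null : leb1 R vlimit = 0%E.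
Proof.
apply: (le_geometric_eq0 (a := tau^-1 * m0) tauV_lt1) => // k.
rewrite -mulrA; apply: le_trans (levels_mass (mass_decay k)).2.
apply: le_measure; rewrite ?inE; first exact: measurable_vlimit.
  apply: measurable_vlevel; last exact: stage_sub.
  exact: measurable_stage.
by move=> y; apply.
Qed.

Lemma residual_sub_limits : residual `<=` vlimit `*` hlimit.
Proof.
by move=> z rz; split=> k _; have /stageS_hv[_ ? ?] := rz k.+1 I.
Qed.

Lemma residual_null : leb2 R residual = 0%E.
Proof.
have mvh := measurableX measurable_vlimit measurable_hlimit.
have vh0 : leb2 R (vlimit `*` hlimit) = 0%E.
  rewrite product_measure1E; [|exact: measurable_vlimit|exact: measurable_hlimit].
  by rewrite [X in (_ * X)%E]hlimit_null mule0.
apply/eqP; rewrite -measure_le0 -vh0; apply: le_measure; rewrite ?inE//.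
  exact: measurable_residual.
exact: residual_sub_limits.
Qed.

(* If no stage has horizontal mass at most tau at height y, the row of Omega1 at
   height y lies in the residual set, hence in the null set vlimit. *)
Lemma Omega1_row y :
  (\int[leb1 R]_s `|(f \_ (Omega1 tau Omega f)) (s, y)|%:E <= tau%:E)%E.
Proof.
have mrow A : measurable A -> A `<=` Omega ->
    measurable_fun setT (fun s => `|(f \_ A) (s, y)|%:E).
  move=> mA AO; apply/measurable_EFinP; apply: measurableT_comp => //.
  exact: measurableT_comp (measurable_patch mA AO) (pair2_measurable y).
have [exk|noh] := pselect (exists k, (hmass f (stage k) y <= tau%:E)%E).
  (* A point of this row assigned to [Omega1] at stage [j] has a light row there, so [k <= j] and
     the point lies in stage [k]; residual points lie in every stage. *)
  have [k hk kmin] := ex_minnP exk.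
  apply: le_trans hk; apply: ge0_le_integral => //.
  - apply: mrow; first exact: measurable_Omega1.
    exact: Omega1_sub.
  - by apply: mrow; [exact: measurable_stage|exact: stage_sub].
  move=> s _; rewrite lee_fin !patchE; case: ifPn => [|_]; last by rewrite normr0.
  rewrite inE => O1; rewrite mem_set//.
  case: O1 => [[j _ [jz hj]]|]; last exact.
  exact: stage_anti (kmin j hj) _ jz.
rewrite (_ : (\int[_]_s _)%E = 0%E) ?lee_fin ?(ltW tau_gt0)//.
have sub s : Omega1 tau Omega f (s, y) -> vlimit s.
  move=> [[k _ [_ hk]]|/residual_sub_limits[]//].
  by exfalso; apply: noh; exists k.
have mg := mrow _ measurable_Omega1.
rewrite (_ : (fun s => _) =
    (fun s => `|(f \_ (Omega1 tau Omega f)) (s, y)|%:E) \_ vlimit); last first.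
  apply/funext => s; rewrite [RHS]patchE; case: ifPn => // sv.
  rewrite patchE memNset ?normr0// => /sub vs; move: sv.
  by rewrite mem_set.
rewrite -integral_mkcond; apply: null_set_integral vlimit_null.
  exact: measurable_vlimit.
exact: measurable_funS (mg Omega1_sub).
Qed.

(** The first stage with a light column contains the column of [Omega2]. If there is none, that
    column is empty, because [Omega2] receives no residual points. *)
Lemma Omega2_column x :
  (\int[leb1 R]_s `|(f \_ (Omega2 tau Omega f)) (x, s)|%:E <= tau%:E)%E.
Proof.
have mcol A : measurable A -> A `<=` Omega ->
    measurable_fun setT (fun s => `|(f \_ A) (x, s)|%:E).
  move=> mA AO; apply/measurable_EFinP; apply: measurableT_comp => //.
  exact: measurableT_comp (measurable_patch mA AO) (pair1_measurable x).
have [exk|nov] := pselect (exists k, (vmass f (stage k) x <= tau%:E)%E).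
  have [k vk kmin] := ex_minnP exk.
  apply: le_trans vk; apply: ge0_le_integral => //.
  - apply: mcol; first exact: measurable_Omega2.
    exact: Omega2_sub.
  - by apply: mcol; [exact: measurable_stage|exact: stage_sub].
  move=> s _; rewrite lee_fin !patchE; case: ifPn => [|_]; last by rewrite normr0.
  rewrite inE => -[j _ [[jz _] vj]]; rewrite mem_set//.
  exact: stage_anti (kmin j vj) _ jz.
rewrite integral0_eq ?lee_fin ?(ltW tau_gt0)// => s _.
rewrite patchE memNset ?normr0// => -[k _ [_ vk]].
by apply: nov; exists k.
Qed.

End decay.

End splitting.

(** * The weak norm and the main theorem *)

Section weak_norm.
Context {R : realType}.
Implicit Types (Omega E : set (R * R)) (f : R * R -> R).

Lemma bounded_measure_lty Omega : bounded_set Omega -> measurable Omega ->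
  (leb2 R Omega < +oo)%E.
Proof.
move=> [M [_ MO]] mO; apply: (le_lt_trans _ (square_measure_lty (M + 1))).
apply: le_measure; rewrite ?inE//.
  by apply: measurableX; exact: measurable_itv.
by move=> z Oz; apply/squareP; apply: MO Oz; rewrite ltrDl.
Qed.

(** For each [E] the inequality passes to the infimum of the constants after division by the square
    root of the measure of [E]; if that is 0, both sides vanish. *)
Lemma weakL2_norm_attained Omega f : (leb2 R Omega < +oo)%E ->
  measurable (Omega : set (measurableTypeR R * measurableTypeR R)) ->
  weakL2 Omega f ->
  exists2 N : R, 0 <= N /\ weakL2_norm Omega f = N%:E &
    forall E, measurable E -> E `<=` Omega ->
      (\int[leb2 R]_(z in E) `|f z|%:E <= N%:E * (leb2 R E) `^ 2^-1)%E.
Proof.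
move=> Ofin mO [mf]; rewrite /weakL2_norm; set S := [set C%:E | C in _] => Soo.
have S0 : (0 <= ereal_inf S)%E.
  by apply: le_ereal_inf_tmp => _ [C [C0 _] <-]; rewrite lee_fin.
have Sfin : ereal_inf S \is a fin_num by rewrite ge0_fin_numE.
exists (fine (ereal_inf S)); first by rewrite fine_ge0// fineK.
move=> E mE EO; rewrite fineK//.
(* Finiteness of the norm yields one admissible constant [C0]; it makes the integral over [E] finite
   and settles the case of a null set. *)
have [_ [C0 [C00 C0P] <-] _] := ereal_inf_lt Soo.
have [p p0 Ep] : exists2 p : R, 0 <= p & (leb2 R E `^ 2^-1 = p%:E)%E.
  have : (leb2 R E `^ 2^-1 < +oo)%E.
    by apply/poweR_lty/(le_lt_trans _ Ofin)/le_measure; rewrite ?inE.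
  move=> Eoo; exists (fine (leb2 R E `^ 2^-1)%E); first by rewrite fine_ge0 ?poweR_ge0.
  by rewrite fineK// ge0_fin_numE ?poweR_ge0.
have := C0P E mE EO; rewrite Ep => IC0.
have [i Ei] : exists i : R, (\int[leb2 R]_(z in E) `|f z|%:E = i%:E)%E.
  exists (fine (\int[leb2 R]_(z in E) `|f z|%:E)%E); rewrite fineK//.
  rewrite ge0_fin_numE ?integral_ge0//.
  by rewrite (le_lt_trans IC0)// -EFinM ltry.
have [p_eq0|p_neq0] := eqVneq p 0.
  by move: IC0; rewrite p_eq0 !mule0.
have p_gt0 : 0 < p by rewrite lt_neqAle eq_sym p_neq0.
rewrite Ei -lee_pdivrMr//; apply: le_ereal_inf_tmp => _ [C [C_ge0 CP] <-].
by rewrite lee_pdivrMr// -Ei -Ep; exact: CP.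
Qed.

End weak_norm.

(** * The fields built from the two pieces of the splitting *)

Section algorithm_field.
Context {R : realType}.
Variables (tau : R) (Omega : set (R * R)) (f : R * R -> R).
Hypothesis tau_gt1 : 1 < tau.
Hypothesis mO : measurable (Omega : set (measurableTypeR R * measurableTypeR R)).
Hypothesis Omega_fin : (leb2 R Omega < +oo)%E.
Hypothesis mf : measurable_fun Omega f.
Hypothesis f_weak : forall E : set (R * R), measurable E -> E `<=` Omega ->
  (\int[leb2 R]_(z in E) `|f z|%:E <= (leb2 R E) `^ 2^-1)%E.

Let f1 := f \_ (Omega1 tau Omega f).
Let f2 := f \_ (Omega2 tau Omega f).

Lemma integrable_patch A : measurable (A : set (measurableTypeR R * measurableTypeR R)) ->
  A `<=` Omega ->
  (leb2 R).-integrable setT (EFin \o f \_ A).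
Proof.
move=> mA AO; rewrite -restrict_EFin; apply/(integrable_mkcond _ _).1 => //.
apply/integrableP; split; first by apply/measurable_EFinP; exact: measurable_funS mf.
rewrite (le_lt_trans (f_weak mA AO))// poweR_lty//.
by rewrite (le_lt_trans _ Omega_fin)//; apply: le_measure; rewrite ?inE.
Qed.

Lemma split_sum z : f1 z + f2 z = (f \_ Omega) z.
Proof.
have U := Omega12U tau Omega f; have I12 := Omega12I tau Omega f.
rewrite /f1 /f2 !patchE.
have [z1|z1] := pselect (Omega1 tau Omega f z).
  have nz2 : ~ Omega2 tau Omega f z.
    by move=> z2; have : (Omega1 tau Omega f `&` Omega2 tau Omega f) z by [];
       rewrite I12.
  rewrite (mem_set z1) (memNset nz2) addr0 mem_set//; exact: Omega1_sub z1.
rewrite (memNset z1) add0r.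
have [z2|nz2] := pselect (Omega2 tau Omega f z).
  by rewrite !mem_set//; exact: Omega2_sub z2.
by rewrite !memNset// -U => -[].
Qed.

(** This covers both fields at once: [c = 0] for the plain primitives, [c = 1/2] for the balanced
    ones. The factor [N], which undoes the normalisation, is moved onto [f1] and [f2] by linearity,
    so that the line bound becomes [N * tau]. *)
Lemma scaled_primitives (c N : R) : 0 <= N ->
  let u z := (N * hprimitive c f1 z, N * vprimitive c f2 z) in
  [/\ measurable_fun setT u,
      distributional_div u (fun z => N * (f \_ Omega) z) &
      forall z, `|(u z).1| <= Num.max `|c| `|1 - c| * (N * tau) /\
                `|(u z).2| <= Num.max `|c| `|1 - c| * (N * tau)].
Proof.
move=> N0 u.
have mO1 := measurable_Omega1 tau mO mf; have mO2 := measurable_Omega2 tau mO mf.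
have sO1 := Omega1_sub (tau := tau) (Omega := Omega) (f := f).
have sO2 := Omega2_sub (tau := tau) (Omega := Omega) (f := f).
have mf1 : measurable_fun setT f1 by exact: measurable_patch mf _ mO1 sO1.
have mf2 : measurable_fun setT f2 by exact: measurable_patch mf _ mO2 sO2.
have f1B := Omega1_row mO mf tau_gt1 Omega_fin f_weak.
have f2B := Omega2_column mO mf tau_gt1.
have scale_le (h : R -> R) : measurable_fun setT h ->
    (\int[leb1 R]_s `|h s|%:E <= tau%:E)%E ->
    (\int[leb1 R]_s `|N * h s|%:E <= (N * tau)%:E)%E.
  move=> mh htau; under eq_integral do rewrite normrM EFinM.
  rewrite ge0_integralZl//; last by apply/measurable_EFinP; exact: measurableT_comp.
  by rewrite ger0_norm// EFinM lee_wpmul2l.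
have F1B y : (\int[leb1 R]_s `|N * f1 (s, y)|%:E <= (N * tau)%:E)%E.
  apply: scale_le; last exact: f1B.
  exact: measurableT_comp mf1 (pair2_measurable y).
have F2B x : (\int[leb1 R]_s `|N * f2 (x, s)|%:E <= (N * tau)%:E)%E.
  apply: scale_le; last exact: f2B.
  exact: measurableT_comp mf2 (pair1_measurable x).
have mF1 : measurable_fun setT (fun z => N * f1 z) by exact: measurable_funM.
have mF2 : measurable_fun setT (fun z => N * f2 z) by exact: measurable_funM.
have iF1 := integrableZl measurableT N (integrable_patch mO1 sO1).
have iF2 := integrableZl measurableT N (integrable_patch mO2 sO2).
have uE : u = fun z => (hprimitive c (fun w => N * f1 w) z,
                        vprimitive c (fun w => N * f2 w) z).
  apply/funext => z; rewrite /u /hprimitive /vprimitive !line_primitiveZ//.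
    apply/integrableP; split; last by rewrite (le_lt_trans (f2B _))// ltry.
    by apply/measurable_EFinP; exact: measurableT_comp mf2 (pair1_measurable z.1).
  exact: row_integrable mf1 f1B z.2.
rewrite uE; split.
- apply: measurable_fun_pair; first exact: measurable_hprimitive mF1 F1B.
  exact: measurable_vprimitive mF2 F2B.
- have := distributional_div_primitives c mF1 mF2 F1B F2B iF1 iF2.
  congr distributional_div; apply/funext => z.
  by rewrite -mulrDr split_sum.
- by move=> z; split; [exact: normr_hprimitive mF1 F1B z|
                       exact: normr_vprimitive mF2 F2B z].
Qed.

End algorithm_field.

(** Two components of size at most [B / 2] have squares summing to at most [B ^+ 2 / 2]; this is
    what balancing the field achieves. *)
Lemma eucl_norm_le (R : realType) (B : R) (v : R * R) :
  0 <= B -> `|v.1| <= 2^-1 * B -> `|v.2| <= 2^-1 * B -> eucl_norm v <= B.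
Proof.
move=> B0 v1 v2; rewrite -(ger0_norm B0) -sqrtr_sqr /eucl_norm ler_wsqrtr//.
have sq (x : R) : `|x| <= 2^-1 * B -> x ^+ 2 <= (2^-1 * B) ^+ 2.
  by move=> xB; rewrite -real_normK ?num_real// ler_pXn2r// nnegrE mulr_ge0.
by have := sq _ v1; have := sq _ v2; nra.
Qed.

Lemma primitive_fieldE (R : realType) (f1 f2 : R * R -> R) :
  primitive_field f1 f2 = fun z => (hprimitive 0 f1 z, vprimitive 0 f2 z).
Proof.
apply/funext => z; rewrite /hprimitive /vprimitive /line_primitive.
by rewrite !mul0r !subr0.
Qed.

(** This serves the case of vanishing weak norm, where the field is 0 while [f] is 0 only almost
    everywhere on [Omega]. *)
Lemma distributional_div_ae (R : realType) (u : R * R -> R * R)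
    (f g : R * R -> R) :
  measurable_fun setT f -> measurable_fun setT g ->
  {ae leb2 R, forall z, f z = g z} ->
  distributional_div u f -> distributional_div u g.
Proof.
move=> mf mg fg divf phi tphi; rewrite (divf phi tphi); congr (- fine _).
have [/(_ 0%N)[cphi _] _] := tphi.
have mphi := continuous_prod_measurable_fun cphi.
apply: ae_eq_integral => //.
- by apply/measurable_EFinP; exact: measurable_funM.
- by apply/measurable_EFinP; exact: measurable_funM.
apply: filterS fg; first exact: (ae_filter_ringOfSetsType (leb2 R)).
by move=> z /= fgz _; rewrite fgz.
Qed.

Theorem mainTheorem5 (R : realType) (tau : R) (htau : 1 < tau) :
  (forall (Omega : set (R * R)) (f : R * R -> R),
     bounded_set Omega -> measurable Omega -> weakL2 Omega f ->
     let u := solution tau Omega f in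
     [/\ measurable_fun setT u,
         distributional_div u (f \_ Omega) &
         (Linfty_norm u <= tau%:E * weakL2_norm Omega f)%E])
  /\
  (forall (r : R) (f : R * R -> R),
     0 < r -> weakL2 (square r) f -> weakL2_norm (square r) f = 1%E ->
     let O1 := Omega1 tau (square r) f in
     let O2 := Omega2 tau (square r) f in
     let f1 := f \_ O1 in
     let f2 := f \_ O2 in
     let u := primitive_field f1 f2 in
     [/\ [/\ measurable O1, measurable O2,
             O1 `|` O2 = square r, O1 `&` O2 = set0 &
             leb2 R (residual tau (square r) f) = 0%E],
         (forall y : R, (\int[leb1 R]_s `|f1 (s, y)|%:E <= tau%:E)%E),
         (forall x : R, (\int[leb1 R]_s `|f2 (x, s)|%:E <= tau%:E)%E),
         (measurable_fun setT u /\ distributional_div u (f \_ (square r))) &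
         (forall z : R * R, `|(u z).1| <= tau /\ `|(u z).2| <= tau)]).
Proof.
split.
  move=> Omega f bO mO wf u.
  have Ofin := bounded_measure_lty bO mO; have [mf _] := wf.
  have [N [N0 NE] NP] := weakL2_norm_attained Ofin mO wf.
  pose g := (fun w => f w / N) \_ Omega.
  have mfN : measurable_fun Omega (fun w => f w / N) by exact: measurable_funM.
  have mgT : measurable_fun setT g by exact/(measurable_restrictT _ _).1.
  have mg : measurable_fun Omega g by exact: measurable_funS mgT.
  have g_weak E : measurable E -> E `<=` Omega ->
      (\int[leb2 R]_(z in E) `|g z|%:E <= (leb2 R E) `^ 2^-1)%E.
    move=> mE EO.
    have -> : (\int[leb2 R]_(z in E) `|g z|%:E =
        (N^-1)%:E * \int[leb2 R]_(z in E) `|f z|%:E)%E.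
      rewrite -ge0_integralZl//; last 2 first.
      - by apply/measurable_EFinP; apply: measurableT_comp => //;
          exact: measurable_funS mf.
      - by rewrite lee_fin invr_ge0.
      apply: eq_integral => z; rewrite inE => Ez.
      rewrite /g patchE mem_set; last exact: EO.
      by rewrite normrM normfV (ger0_norm N0) mulrC EFinM.
    (* For [N = 0] the inverse is 0 by convention, so the left-hand side vanishes. *)
    have [->|N_neq0] := eqVneq N 0; first by rewrite invr0 mul0e poweR_ge0.
    have N_gt0 : 0 < N by rewrite lt_neqAle eq_sym N_neq0.
    by rewrite lee_pdivrMl//; exact: NP.
  (* The choice [c = 1/2] minimises the maximum of [|c|] and [|1 - c|], so each component is at most
     [N * tau / 2]. *)
  have [mu divu uB] := scaled_primitives htau mO Ofin mg g_weak 2^-1 N0.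
  have uE : u = fun z =>
      (N * hprimitive 2^-1 (g \_ (Omega1 tau Omega g)) z,
       N * vprimitive 2^-1 (g \_ (Omega2 tau Omega g)) z).
    by apply/funext => z; rewrite /u /solution NE.
  have half : Num.max `|2^-1 : R| `|1 - 2^-1| = 2^-1.
    by rewrite (_ : 1 - 2^-1 = 2^-1 :> R) ?maxxx ?ger0_norm//; lra.
  rewrite uE NE; split; first exact: mu.
    apply: distributional_div_ae divu.
    - apply: measurable_funM => //; apply/(measurable_restrictT _ _).1 => //.
    - exact/(measurable_restrictT _ _).1.
    (* For nonzero [N] the product [N * g] is [f] on [Omega]; for [N = 0] the weak bound on
       [E = Omega] forces [f] to vanish almost everywhere there. *)
    have [N_eq0|N_neq0] := eqVneq N 0; last first.
      apply: aeW => z; rewrite /g !patchE; case: ifPn => [zO|_]; last by rewrite mulr0.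
      by rewrite zO mulrCA divff// mulr1.
    have f0 : (\int[leb2 R]_(z in Omega) `|(f z)%:E| = 0)%E.
      apply/eqP; rewrite eq_le integral_ge0// andbT.
      by have := NP _ mO (@subset_refl _ _); rewrite N_eq0 mul0e.
    have mfE : measurable_fun Omega (EFin \o f) by exact/measurable_EFinP.
    have := (ae_eq_integral_abs (leb2 R) mO mfE).1 f0.
    apply: (@filterS _ _ (ae_filter_ringOfSetsType (leb2 R))).
    move=> z /= fz; rewrite N_eq0 mul0r patchE; case: ifPn => //.
    by rewrite inE => /fz [->].
  apply: ess_sup_ler => z; rewrite lee_fin.
  have tauN : 0 <= N * tau by rewrite mulr_ge0// ltW// (lt_trans ltr01).
  have [u1 u2] := uB z; rewrite half in u1 u2.
  by rewrite [leRHS]mulrC; exact: eucl_norm_le u1 u2.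
move=> r f r0 wf norm1 O1 O2 f1 f2 u.
have mS : measurable (square r : set (measurableTypeR R * measurableTypeR R)).
  by apply: measurableX; exact: measurable_itv.
have Sfin := square_measure_lty r.
have [mf _] := wf.
have [N [_ NE] NP] := weakL2_norm_attained Sfin mS wf.
have N1 : N = 1 by move: NE; rewrite norm1 => -[].
have f_weak E : measurable E -> E `<=` square r ->
    (\int[leb2 R]_(z in E) `|f z|%:E <= (leb2 R E) `^ 2^-1)%E.
  by move=> mE ES; have := NP E mE ES; rewrite N1 mul1e.
(* With [c = 0] and [N = 1] the field is [primitive_field] itself, and the kernel bound 1 gives
   components of size at most [tau]. *)
have [mu divu uB] := scaled_primitives htau mS Sfin mf f_weak 0 ler01.
have uE : u = fun z => (1 * hprimitive 0 f1 z, 1 * vprimitive 0 f2 z).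
  by rewrite /u primitive_fieldE; apply/funext => z; rewrite !mul1r.
split.
- split.
  + exact: measurable_Omega1.
  + exact: measurable_Omega2.
  + exact: Omega12U.
  + exact: Omega12I.
  + exact: residual_null f_weak.
- exact: Omega1_row f_weak.
- exact: Omega2_column.
- rewrite uE; split; first exact: mu.
  by move: divu; congr distributional_div; apply/funext => z; rewrite mul1r.
- move=> z; rewrite uE; have := uB z.
  by rewrite normr0 subr0 normr1 (max_idPr ler01) !mul1r.
Qed.
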